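(* Let $X$ be a reflexive and strictly convex Banach space with property UKK. Then, for any nonempty convex subsets $A,B\subseteq X$, the pair $(A,B)$ has property WUC.
   Context: A Banach space $X$ has property UKK (uniform Kadec-Klee property) if for any $\varepsilon>0$ the number $\eta(\varepsilon)=\inf\{1-\|x\|\}$ is $>0$, where the infimum is taken over all points $x$ such that $x$ is the weak limit of some sequence $\{x_n\}$ in the unit ball of $X$ with $\|x_n-x\|\ge\varepsilon$ for all $n$ (the infimum of the empty set being $+\infty$). $\operatorname{dist}(A,B)=\inf\{\|x-y\|: x\in A,\ y\in B\}$. The pair $(A,B)$ has property WUC if every sequence $\{x_m\}\subseteq A$ with the following property is convergent (in norm, in $X$): for every $\varepsilon>0$ there exist $y\in B$ and $m_0\in\mathbb N$ such that $\|x_m-y\|\le\operatorname{dist}(A,B)+\varepsilon$ for all $m\ge m_0$. *)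

(* Defs.v *)
From HB Require Import structures.
From mathcomp Require Import all_boot all_order all_algebra.
From mathcomp Require Import all_classical all_reals all_analysis.

Set Implicit Arguments.
Unset Strict Implicit.
Unset Printing Implicit Defensive.

Import Order.TTheory GRing.Theory Num.Theory.
Import numFieldNormedType.Exports.

Local Open Scope classical_set_scope.
Local Open Scope ring_scope.

Definition in_dual (R : realType) (X : normedModType R) : {pred X -> R^o} :=
  fun f => `[< linear f /\ continuous f >].

Record dual (R : realType) (X : normedModType R) := Dual {
  dual_fun :> X -> R^o;
  dual_funP : dual_fun \in @in_dual R X
}.

HB.instance Definition _ (R : realType) (X : normedModType R) :=
  [isSub for @dual_fun R X].
HB.instance Definition _ (R : realType) (X : normedModType R) :=
  [Choice of dual X by <:].

Section dual_lmodule.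
Context {R : realType} {X : normedModType R}.

Lemma in_dual_submod_closed : submod_closed (@in_dual R X).
Proof.
split=> [|a f g /asboolP[lf cf] /asboolP[lg cg]]; apply/asboolP; split.
- by move=> a x y; rewrite scaler0 addr0.
- by move=> x; exact: cvg_cst.
- move=> b x y; rewrite !fctE lf lg.
  by rewrite !scalerDr !scalerA mulrC addrACA.
- move=> x; apply: cvgD; last exact: cg.
  by apply: cvgZl_tmp; exact: cf.
Qed.

HB.instance Definition _ :=
  GRing.isSubmodClosed.Build R (X -> R^o) (@in_dual R X) in_dual_submod_closed.
HB.instance Definition _ := [SubChoice_isSubLmodule of dual X by <:].

End dual_lmodule.

Section dual_norm.
Context {R : realType} {X : normedModType R}.
Implicit Types f g : dual X.

Definition dual_norm f : R := sup [set `|f x| | x in [set x | `|x| <= 1]].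

Lemma dual_linear f : linear f.
Proof. by have /asboolP[] := dual_funP f. Qed.

Lemma dual_continuous f : continuous f.
Proof. by have /asboolP[] := dual_funP f. Qed.

HB.instance Definition _ f :=
  GRing.isLinear.Build R X R^o *:%R (dual_fun f) (dual_linear f).

Lemma dual_addE f g x : (f + g) x = f x + g x.
Proof. by []. Qed.

Lemma dual_scaleE (a : R) f x : (a *: f) x = a * f x.
Proof. by []. Qed.

Lemma dual_norm_has_sup f : has_sup [set `|f x| | x in [set x | `|x| <= 1]].
Proof.
split; first by exists `|f 0|, 0 => //=; rewrite normr0.
have /linear_bounded_continuous/linear_boundedP/pinfty_ex_gt0[M M0 fM] :=
  @dual_continuous f.
exists M => _ [x /= x1 <-]; apply: (le_trans (fM x)).
by rewrite -[leRHS]mulr1 ler_wpM2l// ltW.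
Qed.

Lemma dual_norm_ub f x : `|x| <= 1 -> `|f x| <= dual_norm f.
Proof. by move=> x1; apply: (sup_upper_bound (dual_norm_has_sup f)); exists x. Qed.

Lemma dual_norm_le f (M : R) :
  (forall x, `|x| <= 1 -> `|f x| <= M) -> dual_norm f <= M.
Proof.
move=> fM; apply: ge_sup; first by case: (dual_norm_has_sup f).
by move=> _ [x /= x1 <-]; exact: fM.
Qed.

Lemma dual_norm_ge0 f : 0 <= dual_norm f.
Proof. by apply: (le_trans (normr_ge0 (f 0))); rewrite dual_norm_ub// normr0. Qed.

Lemma ler_dual_norm f x : `|f x| <= dual_norm f * `|x|.
Proof.
have [->|x0] := eqVneq x 0; first by rewrite linear0 !normr0 mulr0.
rewrite -ler_pdivrMr ?normr_gt0//.
have -> : `|f x| / `|x| = `|f (`|x|^-1 *: x)|.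
  by rewrite linearZ normrM normfV normr_id mulrC.
by rewrite dual_norm_ub// normrZ normfV normr_id mulVf// normr_eq0.
Qed.

Lemma ler_dual_normD f g : dual_norm (f + g) <= dual_norm f + dual_norm g.
Proof.
apply: dual_norm_le => x x1; rewrite dual_addE.
by rewrite (le_trans (ler_normD _ _))// lerD// dual_norm_ub.
Qed.

Lemma dual_normZ (a : R) f : dual_norm (a *: f) = `|a| * dual_norm f.
Proof.
apply/le_anti/andP; split.
  apply: dual_norm_le => x x1; rewrite dual_scaleE normrM.
  by rewrite ler_wpM2l// dual_norm_ub.
have [->|a0] := eqVneq a 0; first by rewrite normr0 mul0r dual_norm_ge0.
rewrite -ler_pdivlMl ?normr_gt0//; apply: dual_norm_le => x x1.
by rewrite ler_pdivlMl ?normr_gt0// -normrM -dual_scaleE dual_norm_ub.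
Qed.

Lemma dual_norm0_eq0 f : dual_norm f = 0 -> f = 0.
Proof.
move=> f0; apply/val_inj/funext => x /=.
by apply/eqP; rewrite -normr_le0 (le_trans (ler_dual_norm f x))// f0 mul0r.
Qed.

HB.instance Definition _ := Lmodule_isNormed.Build R (dual X)
  ler_dual_normD dual_normZ dual_norm0_eq0.

Lemma dual_normE f : `|f| = dual_norm f.
Proof. by []. Qed.

End dual_norm.

Section bidual.
Context {R : realType} {X : normedModType R}.

Definition evaluation (x : X) (f : dual X) : R^o := f x.

Lemma evaluation_in_dual x : evaluation x \in @in_dual R (dual X).
Proof.
apply/asboolP; have lx : linear (evaluation x) by [].
split => //.
pose e : {linear dual X -> R^o} :=
  HB.pack (evaluation x) (GRing.isLinear.Build _ _ _ _ _ lx).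
apply: (@bounded_linear_continuous _ _ _ e); apply/linear_boundedP.
exists `|x|; split=> [|r /ltW xr f /=]; first exact: num_real.
rewrite (le_trans (ler_dual_norm f x))// mulrC ler_wpM2r//.
exact: dual_norm_ge0.
Qed.

Definition to_bidual (x : X) : dual (dual X) := Dual (evaluation_in_dual x).

End bidual.

Section banach_space_properties.
Context {R : realType}.

Definition reflexive_space (X : normedModType R) : Prop :=
  range (@to_bidual R X) = [set: dual (dual X)].

Definition strictly_convex (X : normedModType R) : Prop :=
  forall x y : X, `|x| = 1 -> `|y| = 1 -> x != y -> `|2^-1 *: (x + y)| < 1.

Definition weakly_cvg (X : normedModType R) (u : nat -> X) (x : X) : Prop :=
  forall f : dual X, f (u n) @[n --> \oo] --> f x.

(* The infimum is taken in the extended reals, where inf set0 = +oo. *)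
Definition UKK_modulus (X : normedModType R) (e : R) : \bar R :=
  ereal_inf [set (1 - `|x|)%:E | x in [set x : X |
    exists u : nat -> X, [/\ forall n, `|u n| <= 1,
                             weakly_cvg u x &
                             forall n, e <= `|u n - x|]]].

Definition UKK (X : normedModType R) : Prop :=
  forall e : R, 0 < e -> (0 < UKK_modulus X e)%E.

Definition dist (X : normedModType R) (A B : set X) : R :=
  inf [set `|x - y| | x in A & y in B].

Definition WUC (X : normedModType R) (A B : set X) : Prop :=
  forall u : nat -> X, (forall m, A (u m)) ->
    (forall e : R, 0 < e -> exists y, B y /\ exists m0, forall m, (m0 <= m)%N ->
       `|u m - y| <= dist A B + e) ->
    cvg (u @ \oo).

End banach_space_properties.

(* Main.v *)
Require Import Defs.
From HB Require Import structures.
From mathcomp Require Import all_boot all_order all_algebra.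
From mathcomp Require Import all_classical all_reals all_analysis.
From mathcomp Require Import lra.
Import Order.TTheory GRing.Theory Num.Theory.
Import numFieldNormedType.Exports.
Local Open Scope classical_set_scope.
Local Open Scope ring_scope.

Set Implicit Arguments.
Unset Strict Implicit.

(* Put C = A - B and d = dist(A, B). If u were not Cauchy, one could find y_n in
   B and two subsequences of u whose translates p_n, q_n by - y_n lie in C, have
   norms tending to d and stay at mutual distance at least e. Along a free
   ultrafilter both converge weakly, by reflexivity. Since a continuous
   functional separates the convex set C from the ball of radius d, both limits
   and their midpoint have norm d, so strict convexity makes the limits equal;
   UKK then turns weak into norm convergence, a contradiction. UKK speaks about
   sequences, so a sequence has to be extracted from the ultrafilter: in a
   reflexive space it suffices to follow countably many functionals separating
   the points of the closed span of the sequence. *)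

(** * Convex sets, sublinear functionals and the Hahn-Banach theorem *)

Lemma convex_setP (R : realType) (X : lmodType R) (C : set X) :
  convex_set C <-> forall t x y, 0 <= t -> t <= 1 -> C x -> C y ->
    C (t *: x + (1 - t) *: y).
Proof.
split=> [cC t x y t0 t1 Cx Cy|cC x y l /set_mem Cx /set_mem Cy].
  by have /set_mem := cC x y (Itv01 t0 t1) (mem_set Cx) (mem_set Cy).
by apply/mem_set; apply: cC.
Qed.

(** The cone over [C] is closed under addition, which is what makes [lower_on] subadditive. If
    [s + t = 0], both coefficients vanish and any point of [C] will do. *)
Lemma convex_set_cone (R : realType) (X : lmodType R) (C : set X) s t x y :
  convex_set C -> 0 <= s -> 0 <= t -> C x -> C y ->
  exists2 z, C z & s *: x + t *: y = (s + t) *: z.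
Proof.
move=> /convex_setP cC s0 t0 Cx Cy; have [st0|st0] := eqVneq (s + t) 0.
  exists x => //; move/eqP: st0; rewrite paddr_eq0// => /andP[/eqP-> /eqP->].
  by rewrite addr0 !scale0r addr0.
have stp : 0 < s + t by rewrite lt_def st0 addr_ge0.
exists (s / (s + t) *: x + (1 - s / (s + t)) *: y).
  by apply: cC; rewrite ?divr_ge0 ?ler_pdivrMr ?mul1r ?lerDl// ltW.
have -> : 1 - s / (s + t) = t / (s + t).
  by rewrite -[1](divff st0) -mulrBl addrC addKr.
by rewrite scalerDr !scalerA !(mulrC (s + t)) !divfK.
Qed.

Section sublinear.
Context {R : realType} {X : lmodType R}.
Implicit Types p q : X -> R.

Definition sublinear p := (forall x y, p (x + y) <= p x + p y) /\
  (forall t x, 0 < t -> p (t *: x) <= t * p x).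

Lemma sublinear0 p : sublinear p -> p 0 = 0.
Proof.
case=> pD pZ; apply/le_anti/andP; split.
  have : p 0 <= 2^-1 * p 0 by rewrite -[in leLHS](scaler0 _ 2^-1) pZ ?invr_gt0.
  lra.
by have := pD 0 0; rewrite addr0; lra.
Qed.

Lemma sublinearZ p t x : sublinear p -> 0 <= t -> p (t *: x) = t * p x.
Proof.
move=> sp; rewrite le_eqVlt => /predU1P[<-|t0].
  by rewrite scale0r mul0r sublinear0.
have [_ pZ] := sp; apply/le_anti/andP; split; first exact: pZ.
rewrite -ler_pdivlMl//; apply: le_trans (pZ _ _ _); last by rewrite invr_gt0.
by rewrite scalerA mulVf ?scale1r// gt_eqF.
Qed.

Lemma sublinearN p x : sublinear p -> - p (- x) <= p x.
Proof.
move=> sp; have := sp.1 x (- x); rewrite subrr sublinear0//; lra.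
Qed.

(* The largest sublinear minorant [q] of [p] such that [q (- c) <= - d] for all
   [c] in [C]. *)
Definition lower_on p (C : set X) (d : R) (z : X) : R :=
  inf [set p (z + t *: c) - t * d | t in [set t | 0 <= t] & c in C].

Section lower_on.
Variables (p : X -> R) (C : set X) (d : R).
Hypotheses (sp : sublinear p) (cC : convex_set C) (C0 : C !=set0).
Hypothesis dp : forall c, C c -> d <= p c.

Lemma lower_on_has_inf z :
  has_inf [set p (z + t *: c) - t * d | t in [set t | 0 <= t] & c in C].
Proof.
split.
  by case: C0 => c Cc; exists (p (z + 0 *: c) - 0 * d), 0 => //=; exists c.
(* Subadditivity gives [t * p c <= p (z + t *: c) + p (- z)], and [t * d <= t * p c] by [dp]. *)
exists (- p (- z)) => _ [t /= t0 [c Cc <-]].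
have := sp.1 (z + t *: c) (- z); rewrite addrAC subrr add0r sublinearZ//.
have := ler_wpM2l t0 (dp Cc); lra.
Qed.

Lemma lower_on_le z t c : 0 <= t -> C c ->
  lower_on p C d z <= p (z + t *: c) - t * d.
Proof.
move=> t0 Cc; apply: ge_inf; first by case: (lower_on_has_inf z).
by exists t => //; exists c.
Qed.

Lemma le_lower_on z a :
  (forall t c, 0 <= t -> C c -> a <= p (z + t *: c) - t * d) ->
  a <= lower_on p C d z.
Proof.
move=> H; apply: lb_le_inf; first by case: (lower_on_has_inf z).
by move=> _ [t /= t0 [c Cc <-]]; exact: H.
Qed.

Lemma lower_on_min z : lower_on p C d z <= p z.
Proof.
case: C0 => c Cc; have := lower_on_le z (lexx 0) Cc.
by rewrite scale0r addr0 mul0r subr0.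
Qed.

Lemma lower_onN c : C c -> lower_on p C d (- c) <= - d.
Proof.
move=> Cc; have := lower_on_le (- c) ler01 Cc.
by rewrite scale1r addNr sublinear0// mul1r sub0r.
Qed.

Lemma sublinear_lower_on : sublinear (lower_on p C d).
Proof.
split=> [x y|t x t0].
  rewrite -lerBlDr; apply: le_lower_on => s c s0 Cc.
  rewrite lerBlDr -lerBlDl; apply: le_lower_on => t c' t0 Cc'.
  have [z Cz e] := convex_set_cone cC s0 t0 Cc Cc'.
  have := lower_on_le (x + y) (addr_ge0 s0 t0) Cz.
  rewrite -e addrACA => /le_trans H; rewrite lerBlDl; apply: H.
  have := sp.1 (x + s *: c) (y + t *: c'); lra.
rewrite -ler_pdivrMl//; apply: le_lower_on => s c s0 Cc.
rewrite ler_pdivrMl// mulrBr -(sublinearZ _ sp (ltW t0)) scalerDr scalerA mulrA.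
by apply: lower_on_le => //; rewrite mulr_ge0// ltW.
Qed.

End lower_on.

Lemma convex_set1 (y : X) : convex_set [set y].
Proof.
by apply/convex_setP => t _ _ _ _ /= -> ->; rewrite -scalerDl subrKC scale1r.
Qed.

(* Applied to the singleton [set y], [lower_on] yields a sublinear minorant of [p]
   that is at most [p (x + y) - p y] at [x]. *)
Lemma sublinear_minimal_linear p : sublinear p ->
  (forall q, sublinear q -> (forall x, q x <= p x) -> q = p) ->
  linear (p : X -> R^o).
Proof.
move=> sp pmin.
have pD x y : p (x + y) = p x + p y.
  apply/le_anti/andP; split; first exact: sp.1.
  have dp c : [set y] c -> p y <= p c by move=> ->.
  have y0 : [set y] !=set0 by exists y.
  have := lower_on_le sp y0 dp x ler01 (erefl y).
  rewrite (pmin (lower_on p [set y] (p y))).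
  - by rewrite scale1r mul1r; lra.
  - exact: (sublinear_lower_on sp (@convex_set1 y) y0 dp).
  - exact: lower_on_min.
have pN x : p (- x) = - p x.
  by apply/eqP; rewrite -addr_eq0 addrC -pD subrr sublinear0.
move=> a x y; rewrite pD; congr (_ + _).
have [a0|a0] := leP 0 a; first exact: sublinearZ.
have Na : 0 <= - a by rewrite oppr_ge0 ltW.
by rewrite -[in LHS](opprK a) scaleNr pN sublinearZ// mulNr opprK.
Qed.

(** Instead of extending a functional from subspaces, Zorn's lemma produces a minimal sublinear
    minorant of [p], and minimality forces linearity. *)
Theorem Hahn_Banach p : sublinear p ->
  exists f : X -> R^o, linear f /\ forall x, f x <= p x.
Proof.
move=> sp; pose T := {q | sublinear q /\ forall x, q x <= p x}.
(* The order is reversed, so that a maximal element is a pointwise smallest minorant. *)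
pose le (q r : T) := `[< forall x, sval r x <= sval q x >].
have [|||A Atot|[q [sq qp]] qmax] := @Zorn T le.
- by move=> q; apply/asboolP.
- move=> q r s /asboolP qr /asboolP rs; apply/asboolP => x.
  exact: le_trans (rs x) (qr x).
- move=> [q Hq] [r Hr] /asboolP/= qr /asboolP/= rq; apply: eq_exist.
  by apply/funext => x; apply/le_anti; rewrite qr rq.
- have [->|A0] := eqVneq A set0.
    by exists (exist _ p (conj sp (fun=> lexx _))).
  have /set0P[a Aa] := A0.
  (* The bound of a nonempty chain is its pointwise infimum [m], finite because every member is at
     least [- p (- x)] at [x]. For subadditivity, the smaller of two members of the chain serves at
     both points. *)
  pose V x := [set sval q x | q in A].
  have Vinf x : has_inf (V x).
    split; first by exists (sval a x), a.
    exists (- p (- x)) => _ [q Aq <-]; case: q Aq => q [sq qp] /= _.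
    by apply: le_trans (sublinearN x sq); rewrite lerN2.
  pose m x := inf (V x).
  have mle (q : T) x : A q -> m x <= sval q x.
    by move=> Aq; apply: ge_inf; [case: (Vinf x)|exists q].
  have le_m x b : (forall q : T, A q -> b <= sval q x) -> b <= m x.
    move=> H; apply: lb_le_inf; first by case: (Vinf x).
    by move=> _ [q Aq <-]; exact: H.
  have sm : sublinear m.
    split=> [x y|t x t0].
      rewrite -lerBlDr; apply/le_m => q Aq; rewrite lerBlDr -lerBlDl.
      apply/le_m => r Ar; rewrite lerBlDl.
      have [/asboolP qr|/asboolP rq] := Atot _ _ Aq Ar.
        apply: le_trans (mle _ _ Ar) _; apply: le_trans ((svalP r).1.1 x y) _.
        by rewrite lerD2r.
      apply: le_trans (mle _ _ Aq) _; apply: le_trans ((svalP q).1.1 x y) _.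
      by rewrite lerD2l.
    rewrite -ler_pdivrMl//; apply/le_m => q Aq; rewrite ler_pdivrMl//.
    apply: le_trans (mle _ _ Aq) _; exact: (svalP q).1.2.
  have mp x : m x <= p x by apply: le_trans (mle _ _ Aa) _; exact: (svalP a).2.
  exists (exist _ m (conj sm mp)) => q Aq; apply/asboolP => x /=; exact: mle.
exists q; split=> //; apply: sublinear_minimal_linear => // r sr rq.
have rp x : r x <= p x by exact: le_trans (rq x) (qp x).
by have /(congr1 sval) := qmax (exist _ r (conj sr rp)) (introT (asboolP _) rq).
Qed.

End sublinear.

(** * Supporting and norming functionals *)

Section supporting_functional.
Context {R : realType} {X : normedModType R}.

Lemma dual_of_le_norm (f : X -> R^o) : linear f -> (forall x, f x <= `|x|) ->
  exists g : dual X, g = f :> (X -> R^o).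
Proof.
move=> lf fle.
suff H : f \in @in_dual R X by exists (Dual H).
apply/asboolP; split=> //.
pose e : {linear X -> R^o} := HB.pack f (GRing.isLinear.Build _ _ _ _ _ lf).
apply: (@bounded_linear_continuous _ _ _ e); apply/linear_boundedP.
exists 1; split=> [|r /ltW r1 x /=]; first exact: num_real.
apply: (@le_trans _ _ `|x|); last by rewrite ler_peMl.
rewrite ler_norml fle andbT lerNl.
have -> : - f x = f (- x) by exact/esym/(linearN e).
by rewrite -normrN.
Qed.

(** A linear minorant [f] of [lower_on] for the norm satisfies [f (- c) <= - d] on [C], hence
    [d <= f c]. *)
Lemma supporting_functional (C : set X) (d : R) : convex_set C -> C !=set0 ->
  (forall c, C c -> d <= `|c|) ->
  exists f : dual X, (forall x, f x <= `|x|) /\ (forall c, C c -> d <= f c).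
Proof.
move=> cC C0 dC; have sn : sublinear (@Num.norm R X).
  by split=> [x y|t x t0]; rewrite ?ler_normD// normrZ gtr0_norm.
have [f [lf fle]] := Hahn_Banach (sublinear_lower_on sn cC C0 dC).
have fn x : f x <= `|x| by apply: le_trans (fle x) _; exact: lower_on_min.
have [g gf] := dual_of_le_norm lf fn.
move: fle fn; rewrite -gf => fle fn; exists g; split=> // c Cc.
rewrite -lerN2 -linearN; apply: le_trans (fle _) _; exact: lower_onN.
Qed.

Lemma norming_functional (x : X) :
  exists f : dual X, (forall y, f y <= `|y|) /\ f x = `|x|.
Proof.
have [|||f [fle fx]] := @supporting_functional [set x] `|x|.
- exact: convex_set1.
- by exists x.
- by move=> _ ->.
- by exists f; split=> //; apply/le_anti; rewrite fle fx.
Qed.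

End supporting_functional.

(** * Weak limits along filters and ultrafilters *)

Section weak_limits.
Context {R : realType} {X : normedModType R}.
Implicit Types (F : set_system nat) (u : nat -> X) (x : X).

Definition wcvg F u x := forall f : dual X, f (u n) @[n --> F] --> f x.

(** Compactness of the segment gives a cluster point, and an ultrafilter converges to each of its
    cluster points. *)
Lemma ultra_bounded_cvg F (r : nat -> R^o) (M : R) : UltraFilter F ->
  (forall n, `|r n| <= M) -> cvg (r n @[n --> F]).
Proof.
move=> FU rM.
have [l [_ lcl]] : `[- M, M] `&` cluster (r n @[n --> F]) !=set0.
  by apply: segment_compact; apply: nearW => n; rewrite /= in_itv/= -ler_norml.
apply/cvg_ex; exists l; apply/cvgrPdist_lt => e e0.
have [//|Fc] := in_ultra_setVsetC [set n | `|l - r n| < e] FU.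
have [s [/= les]] := lcl (~` ball l e) (ball l e) Fc (nbhsx_ballx l e e0).
by [].
Qed.

(** The limits of [f (u n)] along [F] depend on [f] linearly and boundedly, so they define an
    element of the bidual; by reflexivity it is evaluation at a point. *)
Lemma reflexive_ultra_wcvg F u (M : R) : UltraFilter F -> reflexive_space X ->
  (forall n, `|u n| <= M) -> exists x, wcvg F u x.
Proof.
move=> FU hrefl uM.
have fu (f : dual X) : cvg (f (u n) @[n --> F]).
  apply: (@ultra_bounded_cvg _ _ (dual_norm f * M)) => n.
  by apply: le_trans (ler_dual_norm f (u n)) _; rewrite ler_wpM2l// dual_norm_ge0.
pose phi (f : dual X) : R^o := lim (f (u n) @[n --> F]).
have lphi : linear phi.
  move=> a f g; apply: cvg_lim => //.
  have -> : (fun n => (a *: f + g) (u n)) =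
    (fun n => a *: (f (u n) : R^o) + (g (u n) : R^o)) by [].
  by apply: cvgD; [apply: cvgZl_tmp; exact: fu|exact: fu].
have M0 : 0 <= M by exact: le_trans (uM 0).
have phiM (f : dual X) : `|phi f| <= M * `|f|.
  rewrite -lim_norm; last exact: fu.
  apply: limr_le; first by apply: is_cvg_norm; exact: fu.
  apply: nearW => n; rewrite mulrC dual_normE.
  by apply: le_trans (ler_dual_norm f (u n)) _; rewrite ler_wpM2l// dual_norm_ge0.
have phiP : phi \in @in_dual R (dual X).
  apply/asboolP; split=> //.
  pose e : {linear dual X -> R^o} :=
    HB.pack phi (GRing.isLinear.Build _ _ _ _ _ lphi).
  apply: (@bounded_linear_continuous _ _ _ e); apply/linear_boundedP.
  exists M; split=> [|r /ltW Mr f /=]; first exact: num_real.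
  by apply: le_trans (phiM f) _; rewrite ler_wpM2r.
have [x _ xphi] : range (@to_bidual R X) (Dual phiP) by rewrite hrefl.
exists x => f; have -> : f x = phi f by rewrite -[phi f]/(Dual phiP f) -xphi.
exact: fu.
Qed.

Lemma wcvgB F u v x y : Filter F -> wcvg F u x -> wcvg F v y ->
  wcvg F (fun n => u n - v n) (x - y).
Proof.
move=> FF ux vy f; rewrite linearB /=.
under eq_fun do rewrite linearB /=.
by apply: cvgB; [exact: ux|exact: vy].
Qed.

(** The bound [d <= f (u n)] for a supporting functional [f] of [C] passes to the limit, and
    [f x <= |x|]. The limit [x] itself may lie outside [C]. *)
Lemma wcvg_convex_ge F u x (C : set X) (d : R) : ProperFilter F ->
  convex_set C -> (forall c, C c -> d <= `|c|) -> (forall n, C (u n)) ->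
  wcvg F u x -> d <= `|x|.
Proof.
move=> FF cC dC Cu ux; have C0 : C !=set0 by exists (u 0).
have [f [fle df]] := supporting_functional cC C0 dC.
apply: le_trans (fle x); rewrite -(cvg_lim _ (ux f))//.
by apply: limr_ge; [apply/cvg_ex; exists (f x)|apply: nearW => n; exact: df].
Qed.

Lemma wcvg_norm_le F u x (d : R) : ProperFilter F -> wcvg F u x ->
  (forall e, 0 < e -> \forall n \near F, `|u n| <= d + e) -> `|x| <= d.
Proof.
move=> FF ux ud; apply/ler_addgt0Pr => e e0.
have [f [fle <-]] := norming_functional x.
rewrite -(cvg_lim _ (ux f))//; apply: limr_le.
  by apply/cvg_ex; exists (f x).
by apply: filterS (ud e e0) => n; exact: le_trans (fle _).
Qed.

End weak_limits.

(** A filter is the intersection of the ultrafilters above it: if [A] is not in [F], the trace of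
    [F] on the complement of [A] is proper and extends to an ultrafilter. *)
Lemma ultra_in_filter T (F : set_system T) (A : set T) : Filter F ->
  (forall G, UltraFilter G -> F `<=` G -> G A) -> F A.
Proof.
move=> FF FA; apply: contrapT => nFA.
have PF : ProperFilter (within (~` A) F).
  split; last exact: within_filter.
  apply: contra_not nFA => H.
  by apply: (@filterS _ _ FF _ _ _ H) => t; exact: contrapT.
have [G [GU FG]] := ultraFilterLemma PF.
have GA : G A by apply: FA => B FB; apply/FG; apply: (@filterS _ _ FF _ _ _ FB).
have GnA : G (~` A) by apply/FG; exact: (@filterS _ _ FF setT _ _ filterT).
by have [t []] := filter_ex (filterI GA GnA).
Qed.

(** * The closed span of a sequence, through rational combinations *)

Section rational_combinations.
Context {R : realType} {X : normedModType R}.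
Variable u : nat -> X.
Implicit Types (s : seq (rat * nat)) (x : X).

(** Rational coefficients keep the combinations countable, so that they can be enumerated by
    [unpickle]. *)
Definition rat_comb s : X := \sum_(a <- s) ratr a.1 *: u a.2.

Definition rat_span_closure : set X :=
  [set x | forall e, 0 < e -> exists s, `|x - rat_comb s| < e].

Lemma rat_span_closure_mem n : rat_span_closure (u n).
Proof.
move=> e e0; exists [:: (1, n)].
by rewrite /rat_comb big_seq1 /= rmorph1 scale1r subrr normr0.
Qed.

Lemma rat_span_closureD x y :
  rat_span_closure x -> rat_span_closure y -> rat_span_closure (x + y).
Proof.
move=> Px Py e e0; have e2 : 0 < e / 2 by rewrite divr_gt0.
have [s xs] := Px _ e2; have [t yt] := Py _ e2; exists (s ++ t).
rewrite /rat_comb big_cat/= opprD addrACA (splitr e).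
by apply: le_lt_trans (ler_normD _ _) _; rewrite ltrD.
Qed.

Lemma rat_span_closureZ (r : R) x :
  rat_span_closure x -> rat_span_closure (r *: x).
Proof.
move=> Px e e0.
have [s xs] := Px (e / 2 / (`|r| + 1)) ltac:(by rewrite !divr_gt0).
(* The error splits into [r *: (x - rat_comb s)] and [(r - ratr q) *: rat_comb s], each kept below
   or at [e / 2]; the added 1 keeps the denominators positive. *)
pose d := e / 2 / (`|rat_comb s| + 1).
have d0 : 0 < d by rewrite !divr_gt0.
have [q] : exists q : rat, ratr q \in `]r - d, r + d[.
  by apply: rat_in_itvoo; rewrite ltrBlDr -addrA ltrDl addr_gt0.
rewrite in_itv/= => /andP[rq qr].
exists [seq (q * a.1, a.2) | a <- s].
have -> : rat_comb [seq (q * a.1, a.2) | a <- s] = ratr q *: rat_comb s.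
  rewrite /rat_comb big_map scaler_sumr; apply: eq_bigr => a _ /=.
  by rewrite rmorphM scalerA.
have -> : r *: x - ratr q *: rat_comb s =
    r *: (x - rat_comb s) + (r - ratr q) *: rat_comb s.
  by rewrite scalerBr scalerBl addrA subrK.
apply: le_lt_trans (ler_normD _ _) _; rewrite (splitr e) !normrZ.
apply: ler_ltD.
  apply: (@le_trans _ _ (`|r| * (e / 2 / (`|r| + 1)))).
    by rewrite ler_wpM2l// ltW.
  rewrite mulrA ler_pdivrMr ?ltr_wpDl// mulrC ler_wpM2l ?lerDl//.
  by rewrite divr_ge0// ltW.
apply: (@le_lt_trans _ _ (d * `|rat_comb s|)).
  by rewrite ler_wpM2r// ltW// ltr_norml; apply/andP; split; lra.
by rewrite /d mulrAC ltr_pdivrMr ?ltr_wpDl// ltr_pM2l ?ltrDl// divr_gt0.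
Qed.

(** A form of Mazur's theorem. If [x] stayed [e] away from all rational combinations, the convex set
    [C] would avoid the open ball of radius [e / 2], although [u n - x] lies in [C] and tends weakly
    to 0. *)
Lemma wcvg_rat_span_closure (F : set_system nat) x : ProperFilter F ->
  wcvg F u x -> rat_span_closure x.
Proof.
move=> FF ux e e0; apply: contrapT => /forallNP xe.
pose C := [set z - x | z in rat_span_closure].
have cC : convex_set C.
  apply/convex_setP => t _ _ _ _ [y Py <-] [z Pz <-].
  exists (t *: y + (1 - t) *: z).
    by apply: rat_span_closureD; exact: rat_span_closureZ.
  by rewrite !scalerBr addrACA -opprD -scalerDl subrKC scale1r.
have Ce c : C c -> e / 2 <= `|c|.
  move=> [z Pz <-]; have [s zs] := Pz (e / 2) ltac:(by rewrite divr_gt0).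
  have /negP := xe s; rewrite -leNgt => xs.
  rewrite distrC.
  have := ler_distD z x (rat_comb s); lra.
have Cu n : C (u n - x) by exists (u n) => //; exact: rat_span_closure_mem.
have : wcvg F (fun n => u n - x) (x - x).
  by apply: wcvgB => // f; exact: cvg_cst.
by move=> /(wcvg_convex_ge FF cC Ce Cu); rewrite subrr normr0; lra.
Qed.

End rational_combinations.

(** * Extracting weakly convergent sequences from an ultrafilter *)

Section extraction.
Context {R : realType} {X : normedModType R}.
Variable u : nat -> X.

(** The family consists of norming functionals of the rational combinations. If all of them agree at
    [x] and [y], a combination [z] within [e / 2] of [x - y] has norm at most [|z - (x - y)|], so
    [|x - y| < e]. Two filters are allowed because limits along different ultrafilters are compared
    later. *)
Lemma countable_separating : exists g : nat -> dual X,
  forall (F G : set_system nat) x y, ProperFilter F -> ProperFilter G ->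
    wcvg F u x -> wcvg G u y -> (forall j, g j x = g j y) -> x = y.
Proof.
have [f fP] := choice (fun s => norming_functional (rat_comb u s)).
exists (fun j => f (odflt [::] (unpickle j))) => F G x y FF GF ux uy gxy.
have Pxy : rat_span_closure u (x - y).
  apply: rat_span_closureD; first exact: wcvg_rat_span_closure ux.
  rewrite -scaleN1r; apply: rat_span_closureZ.
  exact: wcvg_rat_span_closure uy.
apply/eqP; rewrite -subr_eq0 -normr_le0; apply/ler_addgt0Pr => e e0.
rewrite add0r; have [s xys] := Pxy (e / 2) ltac:(by rewrite divr_gt0).
have [fle fs] := fP s.
have fxy : f s (x - y) = 0.
  rewrite linearB /=; have := gxy (pickle s); rewrite pickleK /= => ->.
  by rewrite subrr.
have := fle (rat_comb u s - (x - y)).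
rewrite linearB /= fxy subr0 fs distrC => sle.
have := ler_normD (x - y - rat_comb u s) (rat_comb u s).
rewrite subrK; lra.
Qed.

Lemma ultra_wcvg_extract (F : set_system nat) (x : X) (S : nat -> set nat)
    (M : R) :
  UltraFilter F -> reflexive_space X -> (forall n, `|u n| <= M) ->
  wcvg F u x -> (forall i, F (S i)) ->
  exists k : nat -> nat, (forall i, S i (k i)) /\ weakly_cvg (u \o k) x.
Proof.
move=> FU hrefl uM ux FS; have [g gP] := countable_separating.
(* The diagonal choice: [k i] lies in [S i] and controls the first [i] functionals up to
   [1 / (i + 1)]. *)
have [i|k kP] := @choice nat nat (fun i n => S i n /\
    forall j : 'I_i, `|g j x - g j (u n)| < i.+1%:R^-1).
  apply: (@filter_ex _ F); apply: filterI => //.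
  apply: filter_forall => j.
  by have /cvgrPdist_lt := ux (g j); apply; rewrite invr_gt0.
exists k; split=> [i|f]; first by have [] := kP i.
(* Convergence is tested on each ultrafilter [G] above [\oo]. There [u \o k] has some weak limit
   [y], which the separating family identifies with [x], viewing it as a limit of [u] along
   [k @ G]. *)
apply/cvgrPdist_lt => e e0; apply: ultra_in_filter => G GU ooG.
have [y uky] := @reflexive_ultra_wcvg _ _ G (u \o k) M GU hrefl
  (fun n => uM (k n)).
suff xy : x = y by have /cvgrPdist_lt := uky f; rewrite -xy; apply.
apply: (gP F (k @ G)) => // j.
have gjx : g j (u (k i)) @[i --> \oo] --> g j x.
  apply/cvgrPdist_lt => d d0; near=> i.
  have ji : (j < i)%N by near: i; exists j.+1.
  apply: lt_trans ((kP i).2 (Ordinal ji)) _.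
  by near: i; exact: near_infty_natSinv_lt (PosNum d0).
have gjG : g j (u (k i)) @[i --> G] --> g j x.
  by exact: cvg_trans (cvg_app _ ooG) gjx.
exact: (cvg_unique _ gjG (uky (g j))).
Unshelve. all: by end_near. Qed.

End extraction.

(** * From weak to norm convergence under UKK and strict convexity *)

Section UKK_convergence.
Context {R : realType} {X : normedModType R}.

Lemma UKK_no_separated_weak_limit (u : nat -> X) x e : UKK X -> 0 < e ->
  (forall n, `|u n| <= 1) -> (forall n, e <= `|u n - x|) ->
  weakly_cvg u x -> `|x| < 1.
Proof.
move=> hUKK e0 u1 ue ux; rewrite -subr_gt0 -lte_fin.
apply: lt_le_trans (hUKK e e0) _; apply: ereal_inf_lbound.
by exists x => //; exists u.
Qed.

(** Otherwise a sequence separated from [x] can be extracted. Dividing its terms by [c i], which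
    tends to [d], puts it in the unit ball with weak limit [d^-1 *: x] of norm 1, against UKK. *)
Lemma UKK_ultra_norm_cvg (F : set_system nat) (u : nat -> X) x (d e : R) :
  UltraFilter F -> \oo `<=` F -> reflexive_space X -> UKK X ->
  0 < d -> `|x| = d -> (forall n, `|u n| <= d + n.+1%:R^-1) ->
  wcvg F u x -> 0 < e -> F [set n | `|u n - x| < e].
Proof.
move=> FU ooF hrefl hUKK d0 xd ud ux e0.
have [//|FS] := in_ultra_setVsetC [set n | `|u n - x| < e] FU.
have e2 : 0 < e / 2 by rewrite divr_gt0.
(* The three conditions give separation from [x], an excess below [e / 2], and [i <= k i], so that
   [c i] tends to [d]. *)
have FSi i : F (~` [set n | `|u n - x| < e] `&` [set n | n.+1%:R^-1 < e / 2]
    `&` [set n | (i <= n)%N]).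
  apply: filterI; last by apply: ooF; exact: nbhs_infty_ge.
  apply: filterI => //; apply: ooF; exact: near_infty_natSinv_lt (PosNum e2).
have uM n : `|u n| <= d + 1.
  by apply: le_trans (ud n) _; rewrite lerD2l invf_le1 ?ltr0Sn// ler1n.
have [k [kS kx]] := ultra_wcvg_extract FU hrefl uM ux FSi.
pose r i : R := (k i).+1%:R^-1; pose c i : R := d + r i.
have r0 i : 0 < r i by rewrite invr_gt0.
have c0 i : 0 < c i by rewrite addr_gt0.
have cd : c i @[i --> \oo] --> d.
  apply/cvgrPdist_lt => a a0; near=> i.
  rewrite /c opprD addrA subrr sub0r normrN gtr0_norm//.
  have [_ /= ik] := kS i.
  apply: (@le_lt_trans _ _ i.+1%:R^-1).
    by rewrite lef_pV2 ?posrE// ler_nat.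
  by near: i; exact: near_infty_natSinv_lt (PosNum a0).
suff : `|d^-1 *: x| < 1.
  by rewrite normrZ xd gtr0_norm ?invr_gt0// mulVf ?ltxx// gt_eqF.
(* With [w] the rescaled difference, [e <= c i * |w| + r i]; since [r i < e / 2] and [c i <= d + 1],
   the separation is at least [e / 2 / (d + 1)]. *)
apply: (@UKK_no_separated_weak_limit (fun i => (c i)^-1 *: u (k i)) _
  (e / 2 / (d + 1))) => // [|i|i|f].
- by rewrite divr_gt0// addr_gt0.
- by rewrite normrZ gtr0_norm ?invr_gt0// ler_pdivrMl// mulr1; exact: ud.
- have [[/= /negP]] := kS i; rewrite -leNgt => eu re _.
  rewrite ler_pdivrMr ?addr_gt0//; set w := _ - _.
  have uw : u (k i) - x = c i *: w + (r i / d) *: x.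
    rewrite /w scalerBr !scalerA divff ?gt_eqF// scale1r -addrA; congr (_ + _).
    rewrite /c mulrDl divff ?gt_eqF// scalerDl scale1r.
    by rewrite opprD -addrA addNr addr0.
  have : e <= c i * `|w| + r i.
    apply: le_trans eu _; rewrite uw; apply: le_trans (ler_normD _ _) _.
    rewrite (normrZ (c i)) (normrZ (r i / d)) xd.
    rewrite (gtr0_norm (c0 i)) gtr0_norm ?divr_gt0//.
    by rewrite divfK// gt_eqF.
  have cd1 : c i <= d + 1 by rewrite lerD2l invf_le1 ?ltr0Sn// ler1n.
  have := ler_wpM2r (normr_ge0 w) cd1; rewrite /= -/(r i) in re; move: re; lra.
- rewrite linearZ /=; under eq_fun do rewrite linearZ /=.
  by apply: cvgM; [apply: cvgV => //; rewrite gt_eqF|exact: kx].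
Unshelve. all: by end_near. Qed.

Lemma minimizing_sequences_close (C : set X) (d e : R) (p q : nat -> X) :
  reflexive_space X -> strictly_convex X -> UKK X ->
  convex_set C -> (forall c, C c -> d <= `|c|) -> 0 <= d -> 0 < e ->
  (forall n, C (p n)) -> (forall n, C (q n)) ->
  (forall n, `|p n| <= d + n.+1%:R^-1) ->
  (forall n, `|q n| <= d + n.+1%:R^-1) ->
  exists n, `|p n - q n| < e.
Proof.
move=> hrefl hsc hUKK cC dC d0 e0 Cp Cq pd qd.
have e2 : 0 < e / 2 by rewrite divr_gt0.
have [F [FU ooF]] := @ultraFilterLemma _ (\oo : set_system nat) _.
have Fe (a : R) : 0 < a -> F [set n | n.+1%:R^-1 < a].
  by move=> a0; apply: ooF; exact: near_infty_natSinv_lt (PosNum a0).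
suff [x [Fpx Fqx]] : exists x, F [set n | `|p n - x| < e / 2] /\
                         F [set n | `|q n - x| < e / 2].
  have [n [/= px qx]] := filter_ex (filterI Fpx Fqx).
  exists n; have := ler_distD x (p n) (q n); rewrite (distrC x); lra.
(* For [d = 0] no normalization is possible, but both sequences tend to 0 in norm. *)
have [dz|dn0] := eqVneq d 0.
  exists 0; split; apply: filterS (Fe _ e2) => n /=; rewrite subr0.
    by apply: le_lt_trans; have := pd n; rewrite dz add0r.
  by apply: le_lt_trans; have := qd n; rewrite dz add0r.
have dp : 0 < d by rewrite lt_def dn0.
have uM (u : nat -> X) : (forall n, `|u n| <= d + n.+1%:R^-1) ->
    forall n, `|u n| <= d + 1.
  move=> ud n; apply: le_trans (ud n) _.
  by rewrite lerD2l invf_le1 ?ltr0Sn// ler1n.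
have norm_lim (u : nat -> X) x : (forall n, C (u n)) ->
    (forall n, `|u n| <= d + n.+1%:R^-1) -> wcvg F u x -> `|x| = d.
  move=> Cu ud ux; apply/le_anti; rewrite (wcvg_convex_ge _ cC dC Cu ux) andbT.
  apply: wcvg_norm_le ux _ => a a0; apply: filterS (Fe _ a0) => n /= na.
  by apply: le_trans (ud n) _; rewrite lerD2l ltW.
have [x px] := reflexive_ultra_wcvg FU hrefl (uM _ pd).
have [y qy] := reflexive_ultra_wcvg FU hrefl (uM _ qd).
have xd := norm_lim _ _ Cp pd px.
have yd := norm_lim _ _ Cq qd qy.
(* The midpoints of [p n] and [q n] stay in [C], so their weak limit also has norm at least [d]. *)
have xyd : d <= `|2^-1 *: (x + y)|.
  apply: (@wcvg_convex_ge _ _ F (fun n => 2^-1 *: (p n + q n)) _ C d _ cC dC).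
  - move=> n; rewrite scalerDr; have half : 2^-1 = 1 - 2^-1 :> R by lra.
    rewrite [X in _ + X *: _]half.
    by apply: ((convex_setP C).1 cC); rewrite ?invr_ge0 ?invf_le1 ?ler1n.
  - move=> f; rewrite linearZ linearD /=.
    under eq_fun do rewrite linearZ linearD /=.
    by apply: cvgM; [exact: cvg_cst|apply: cvgD; [exact: px|exact: qy]].
have xy : x = y.
  apply/eqP/negPn/negP => xy.
  have nz (z : X) : `|z| = d -> `|d^-1 *: z| = 1.
    by move=> zd; rewrite normrZ zd gtr0_norm ?invr_gt0// mulVf.
  have := hsc (d^-1 *: x) (d^-1 *: y) (nz _ xd) (nz _ yd).
  rewrite (inj_eq (scalerI _)) ?invr_eq0// => /(_ xy).
  rewrite -scalerDr scalerA mulrC -scalerA normrZ gtr0_norm ?invr_gt0//.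
  by rewrite ltr_pdivrMl// mulr1 ltNge xyd.
exists x; split; first exact: (UKK_ultra_norm_cvg _ ooF _ _ dp).
by rewrite xy; exact: (UKK_ultra_norm_cvg _ ooF _ _ dp).
Qed.

End UKK_convergence.

(** * Difference sets and the property WUC *)

Lemma convex_setB (R : realType) (X : lmodType R) (A B : set X) :
  convex_set A -> convex_set B -> convex_set [set x - y | x in A & y in B].
Proof.
move=> /convex_setP cA /convex_setP cB; apply/convex_setP.
move=> t _ _ t0 t1 [x Ax [y By <-]] [x' Ax' [y' By' <-]].
exists (t *: x + (1 - t) *: x'); first exact: cA.
exists (t *: y + (1 - t) *: y'); first exact: cB.
by rewrite !scalerBr opprD addrACA.
Qed.

Theorem proposition3p17 (R : realType) (X : completeNormedModType R)
    (hrefl : reflexive_space X) (hsc : strictly_convex X) (hUKK : UKK X)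
    (A B : set X) (hA0 : A !=set0) (hB0 : B !=set0)
    (hA : convex_set A) (hB : convex_set B) :
  WUC A B.
Proof.
move=> u Au uB; pose C : set X := [set x - y | x in A & y in B].
have dC c : C c -> dist A B <= `|c|.
  move=> [x Ax [y By <-]]; apply: ge_inf; last by exists x => //; exists y.
  by exists 0 => _ [? _ [? _ <-]].
have d0 : 0 <= dist A B.
  apply: lb_le_inf; last by move=> _ [? _ [? _ <-]].
  by case: hA0 => x Ax; case: hB0 => y By; exists `|x - y|, x => //; exists y.
have [n|y yP] := @choice nat X (fun n y => B y /\ exists m0,
  forall m, (m0 <= m)%N ->
    `|u m - y| <= dist A B + n.+1%:R^-1).
  by apply: uB; rewrite invr_gt0.
have [n|m0 mP] := @choice nat nat (fun n m0 => forall m, (m0 <= m)%N ->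
    `|u m - y n| <= dist A B + n.+1%:R^-1).
  by have [] := yP n.
apply: cauchy_cvg; apply: cauchy_exP => e e0.
suff [n H] : exists n, forall m, (m0 n <= m)%N -> `|u (m0 n) - u m| < e.
  exists (u (m0 n)); exists (m0 n) => // m /= nm.
  by rewrite -ball_normE /=; exact: H.
(* If no tail from [m0 n] stays within [e] of [u (m0 n)], some [m n >= m0 n] violates this for every
   [n]. Both terms, translated by [- y n], form minimizing sequences in [C], and the translation
   cancels in their difference. *)
apply: contrapT => /forallNP H.
have [n|m mnP] := @choice nat nat (fun n m =>
    (m0 n <= m)%N /\ e <= `|u (m0 n) - u m|).
  have /existsNP[m /not_implyP[nm /negP]] := H n.
  by rewrite -leNgt; exists m.
have [||||n] := @minimizing_sequences_close _ _ C (dist A B) e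
  (fun n => u (m0 n) - y n) (fun n => u (m n) - y n) hrefl hsc hUKK
  (convex_setB hA hB) dC d0 e0.
- by move=> n; exists (u (m0 n)) => //; exists (y n) => //; case: (yP n).
- by move=> n; exists (u (m n)) => //; exists (y n) => //; case: (yP n).
- by move=> n; exact: mP.
- by move=> n; apply: mP; case: (mnP n).
by rewrite opprB addrA subrK ltNge (mnP n).2.
Qed.
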